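(* For every prime $p$ and every integer $k \geq 1$ there is an integer $N_p(k)$ such that, if $M$ is a simple $\mathrm{GF}(p)$-representable matroid with rank $r(M) \geq N_p(k)$, then $M$ contains a rank-$k$ flat $F$ such that either $F$ is independent in $M$, or $M|F \cong \mathrm{AG}(k-1,p)$, or $M|F \cong \mathrm{PG}(k-1,p)$.
   Context: Matroids are finite. $\mathrm{GF}(p)$ is the field with $p$ elements. $M|F$ denotes the restriction of $M$ to $F$. $\mathrm{PG}(k-1,p)$ is the rank-$k$ projective geometry over $\mathrm{GF}(p)$: the simple matroid whose elements are the one-dimensional subspaces of $\mathrm{GF}(p)^k$, with linear independence. $\mathrm{AG}(k-1,p)$ is the rank-$k$ affine geometry over $\mathrm{GF}(p)$: the restriction of $\mathrm{PG}(k-1,p)$ to the complement of a hyperplane. *)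

(* Defs.v *)
From HB Require Import structures.
From mathcomp Require Import all_boot all_algebra.

Set Implicit Arguments.
Unset Strict Implicit.
Unset Printing Implicit Defensive.

Import GRing.Theory.

Section VspaceFinite.
Import VectorInternalTheory.
Variables (K : finFieldType) (vT : vectType K).
HB.instance Definition _ := [Countable of {vspace vT} by <:].
HB.instance Definition _ := [Finite of {vspace vT} by <:].
End VspaceFinite.

Section Matroid.

Record matroid (E : finType) := Matroid {
  indep : pred {set E};
  indep0 : indep set0;
  indepS : forall I J : {set E}, I \subset J -> indep J -> indep I;
  indep_augment : forall I J : {set E}, indep I -> indep J -> #|I| < #|J| ->
    exists2 x, x \in J :\: I & indep (x |: I)
}.

Variables (E : finType) (M : matroid E).
Implicit Types (x y : E) (X F H : {set E}).

Definition rk X : nat := \max_(I : {set E} | (I \subset X) && indep M I) #|I|.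

Definition rank : nat := rk setT.

Definition closure X : {set E} := [set x | rk (x |: X) == rk X].

Definition flat F : bool := closure F == F.

Definition hyperplane H : bool := flat H && ((rk H).+1 == rank).

Definition loop x : bool := ~~ indep M [set x].

Definition parallel x y : bool :=
  [&& x != y, ~~ loop x, ~~ loop y & ~~ indep M [set x; y]].

Definition simple : bool :=
  [forall x, ~~ loop x] && [forall x, forall y, ~~ parallel x y].

End Matroid.

Section Restriction.
Variables (E : finType) (M : matroid E) (F : {set E}).
Implicit Types (X I J : {set {x : E | x \in F}}).

Definition restr_indep : pred {set {x : E | x \in F}} :=
  fun X => indep M (val @: X).

Lemma restr_indep0 : restr_indep set0.
Proof. by rewrite /restr_indep imset0 indep0. Qed.

Lemma restr_indepS I J : I \subset J -> restr_indep J -> restr_indep I.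
Proof. by move=> sIJ; apply: indepS; apply: imsetS. Qed.

Lemma restr_indep_augment I J :
  restr_indep I -> restr_indep J -> #|I| < #|J| ->
  exists2 x, x \in J :\: I & restr_indep (x |: I).
Proof.
move=> iI iJ ltIJ; have: #|val @: I| < #|val @: J|.
  by rewrite !(card_imset _ val_inj).
case/(indep_augment iI iJ) => _ /setDP[/imsetP[x xJ ->] xI] ixI.
exists x; last by rewrite /restr_indep imsetU1.
by rewrite inE xJ andbT; apply: contra xI; apply: imset_f.
Qed.

Definition restr : matroid {x : E | x \in F} :=
  Matroid restr_indep0 restr_indepS restr_indep_augment.

End Restriction.

Definition isomorphic (E1 E2 : finType) (M1 : matroid E1) (M2 : matroid E2) :
    Prop :=
  exists2 f : E1 -> E2, bijective f &
    forall X : {set E1}, indep M2 (f @: X) = indep M1 X.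

Section VectorMatroid.
Variables (K : fieldType) (vT : vectType K) (E : finType) (f : E -> vT).
Implicit Types (X I J : {set E}).

(* [free] is applied to a sequence, so two labels with the same vector are
   dependent. *)
Definition vector_indep : pred {set E} :=
  fun X => free [seq f x | x <- enum X].

Lemma vector_indep0 : vector_indep set0.
Proof. by rewrite /vector_indep enum_set0 nil_free. Qed.

Lemma vector_indepS I J : I \subset J -> vector_indep J -> vector_indep I.
Proof.
move=> sIJ; rewrite /vector_indep => iJ.
have pJ : perm_eq (enum J) (enum I ++ enum (J :\: I)).
  apply: uniq_perm; rewrite ?enum_uniq //.
    rewrite cat_uniq !enum_uniq andbT /=; apply/hasPn=> x.
    by rewrite !mem_enum inE => /andP[].
  move=> x; rewrite mem_cat !mem_enum inE.
  by case: (boolP (x \in I)) => [/(subsetP sIJ) ->|].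
by move: iJ; rewrite (perm_free (perm_map f pJ)) map_cat => /catl_free.
Qed.

Lemma vector_indepU1 x I :
  x \notin I -> vector_indep (x |: I) =
    (f x \notin <<[seq f y | y <- enum I]>>%VS) && vector_indep I.
Proof.
move=> xI; rewrite /vector_indep -free_cons -map_cons.
apply/perm_free/perm_map/uniq_perm; rewrite /= ?enum_uniq ?mem_enum ?xI //.
by move=> y; rewrite !inE !mem_enum !inE.
Qed.

Lemma vector_indep_augment I J :
  vector_indep I -> vector_indep J -> #|I| < #|J| ->
  exists2 x, x \in J :\: I & vector_indep (x |: I).
Proof.
move=> iI iJ; rewrite ltnNge => /negP nJI.
have [/existsP[x /andP[xJ ix]]|] :=
  boolP [exists x, (x \in J :\: I) && vector_indep (x |: I)]; first by exists x.
rewrite negb_exists => /forallP nx; case: nJI.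
move: (iI) (iJ); rewrite /vector_indep /free !size_map -!cardE.
move=> /eqP <- /eqP <-; apply: dimvS; apply/span_subvP=> _ /mapP[x + ->].
rewrite mem_enum => xJ; have := nx x; rewrite inE xJ andbT.
have [xI _|xI] := boolP (x \in I).
  by apply/memv_span/map_f; rewrite mem_enum.
by rewrite /= vector_indepU1 // iI andbT negbK.
Qed.

Definition vector_matroid : matroid E :=
  Matroid vector_indep0 vector_indepS vector_indep_augment.

End VectorMatroid.

Definition representable (K : fieldType) (E : finType) (M : matroid E) : Prop :=
  exists (n : nat) (E' : finType) (f : E' -> 'rV[K]_n),
    isomorphic M (vector_matroid f).

Section ProjectiveGeometry.
Variables (K : finFieldType) (k : nat).

Definition point : finType := {U : {vspace 'rV[K]_k} | \dim U == 1}.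

Implicit Types (X I J : {set point}).

Definition pg_indep : pred {set point} :=
  fun X => directv (\sum_(U in X) val U).

Lemma pg_indepE X :
  pg_indep X = vector_indep (fun U : point => vpick (val U)) X.
Proof.
have pick0 (U : point) : vpick (val U) != 0%R.
  by rewrite vpick0 -dimv_eq0 (eqP (valP U)).
have lineE (U : point) : <[vpick (val U)]>%VS = val U.
  apply/eqP; rewrite eqEdim -memvE memv_pick dim_vline pick0.
  by rewrite (eqP (valP U)).
rewrite /vector_indep free_directv.
have -> /= : 0%R \notin [seq vpick (val U) | U <- enum X].
  by apply/mapP=> -[U _ /esym/eqP]; rewrite (negPf (pick0 U)).
rewrite /pg_indep !directvE /= !big_map !big_enum_cond /=.
congr (\dim _ == _); apply: eq_big => // U; rewrite ?andbT // => _.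
all: by rewrite lineE.
Qed.

Lemma pg_indep0 : pg_indep set0.
Proof. by rewrite pg_indepE vector_indep0. Qed.

Lemma pg_indepS I J : I \subset J -> pg_indep J -> pg_indep I.
Proof. by rewrite !pg_indepE; apply: vector_indepS. Qed.

Lemma pg_indep_augment I J :
  pg_indep I -> pg_indep J -> #|I| < #|J| ->
  exists2 U, U \in J :\: I & pg_indep (U |: I).
Proof.
rewrite !pg_indepE => iI iJ /(vector_indep_augment iI iJ)[U UJI iU].
by exists U; rewrite ?pg_indepE.
Qed.

(* The rank-k projective geometry, usually written PG(k-1, K). *)
Definition PG : matroid point := Matroid pg_indep0 pg_indepS pg_indep_augment.

(* The rank-k affine geometry AG(k-1, K), on the complement of H; it is
   an affine geometry only when H is a hyperplane of PG. *)
Definition AG (H : {set point}) : matroid {U : point | U \in ~: H} :=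
  restr PG (~: H).

End ProjectiveGeometry.

(* Main.v *)
Require Import Defs.
From mathcomp Require Import all_boot all_algebra.

(* Represent M by a set X of vectors over F_p, closed under nonzero scaling, and
   suppose that M has no independent rank-k flat: the span of any k independent
   vectors y_j of X contains a further point of X, that is, X contains some
   combination of the y_j with at least two nonzero coefficients.

   Call an s-letter cube a family x + sum_t q_t h_t, with x and the h_t
   independent and each q_t ranging over a fixed set Q of s scalars.
   - X contains large 2-letter cubes: choose the y_j in disjoint grids
     sum_t a_t e_(t,u_t) contained in X.  The coefficients of the combination in X
     can be made independent of the choice by Ramsey's theorem for products, so
     the combination is again a grid, with at least twice as many nonzero a_t.
   - From s < p letters one passes to s + 1 letters: k-tuples of points of a cube
     are words over the alphabet Q^k, so by the Hales-Jewett theorem the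
     coefficients a_j can be made constant on a large subcube.  The combinations
     then fill a cube over the alphabet sum_j a_j Q, which is larger than Q because
     p is prime and two of the a_j are nonzero.
   Hence X contains a large affine subspace x + V.  By Ramsey's theorem for the
   points of V, we may assume that the nonzero vectors of V are all in X (which
   gives a projective geometry) or all outside X (an affine geometry). *)

Set Implicit Arguments.
Unset Strict Implicit.
Unset Printing Implicit Defensive.

Import GRing.Theory.

(** * The Hales-Jewett theorem *)

Section HalesJewett.

(** [L] encodes a combinatorial subspace of the words over [I]: coordinates labelled [inl] are
    frozen, and those labelled [inr j] all carry the variable [j]. For [J = unit] this is a
    combinatorial line. That every variable occurs is stated separately. *)
Definition subst (I A J : Type) (L : I -> A + J) (w : J -> A) (i : I) : A :=
  match L i with inl a => a | inr j => w j end.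

Definition pair_words (I1 I2 A : finType) (t : I1 -> A) (z : I2 -> A) :
  {ffun I1 + I2 -> A} :=
  [ffun i => match i with inl x => t x | inr y => z y end].

(** The positions where the two words differ are changed from [a] to [b] one at a time. *)
Lemma flip_invariance (J A C : finType) (a b : A) (f : {ffun J -> A} -> C) :
  (forall (w w' : {ffun J -> A}) j, (forall i, i != j -> w i = w' i) ->
     w j = a -> w' j = b -> f w = f w') ->
  forall w w' : {ffun J -> A},
    (forall i, w i = w' i \/ w i = a /\ w' i = b) -> f w = f w'.
Proof.
move=> flip w w'; have [n] := ubnP #|[pred i | w i != w' i]|.
elim: n w => // n IHn w lt_n ww'.
have [/existsP[j wj]|] := boolP [exists j, w j != w' j]; last first.
  rewrite negb_exists => /forallP eq_ww'.
  by congr f; apply/ffunP=> i; have := eq_ww' i; rewrite negbK => /eqP.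
have [wa w'b] : w j = a /\ w' j = b.
  by case: (ww' j) => // /eqP; rewrite (negPf wj).
pose w1 : {ffun J -> A} := [ffun i => if i == j then b else w i].
rewrite (flip w w1 j) //; last first.
- by rewrite ffunE eqxx.
- by move=> i ij; rewrite ffunE (negPf ij).
apply: IHn => [|i]; last first.
  rewrite ffunE; case: (i =P j) => [->|_]; last exact: ww'.
  by left; rewrite w'b.
apply: leq_trans (_ : #|[pred i | w i != w' i]| <= _); last by rewrite -ltnS.
apply: proper_card; apply/properP; split.
  by apply/subsetP=> i; rewrite !inE ffunE; case: (i =P j) => // ->; rewrite w'b eqxx.
by exists j; rewrite !inE // ffunE eqxx w'b eqxx.
Qed.

(* Pigeonhole on the words a...ab...b of the first block: two of them agree in
   every context, and the letters in which they differ form the new variable. *)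
Lemma insensitive_subspace (A : finType) (a b : A) (n : nat) (C : finType) :
  exists I : finType, forall col : {ffun I -> A} -> C,
    exists L : I -> A + 'I_n, (forall j, exists i, L i = inr j) /\
      forall (w w' : {ffun 'I_n -> A}) j, (forall i, i != j -> w i = w' i) ->
        w j = a -> w' j = b ->
        col (finfun (subst L w)) = col (finfun (subst L w')).
Proof.
elim: n C => [|n IHn] C.
  by exists void => col; exists (of_void _); split=> [|w w'] [].
(* An element of [D] records how a first block is coloured in all contexts. A block of length
   [M = #|D|] has room for [M + 1] words of the form a...ab...b. *)
pose D : finType := {ffun {ffun 'I_n -> A} -> C}.
pose M := #|D|.
have [I0 HI0] := IHn {ffun {ffun 'I_M -> A} -> C}.
exists ('I_M + I0)%type => col.
(* The other blocks are coloured by functions of the first block, so the flips found by induction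
   are valid whatever the first block contains. *)
have [L0 [L0var L0flip]] :=
  HI0 (fun z => [ffun t : {ffun 'I_M -> A} => col (pair_words t z)]).
pose T l (c : A) l' : {ffun 'I_M -> A} :=
  [ffun x : 'I_M => if x < l then a else if x < l' then c else b].
pose g (l : 'I_M.+1) : D :=
  [ffun w : {ffun 'I_n -> A} => col (pair_words (T l b l) (finfun (subst L0 w)))].
have [l [l' [lt_ll' gll']]] : exists l l' : 'I_M.+1, l < l' /\ g l = g l'.
  have : ~~ injectiveb g.
    by apply/injectiveP=> /leq_card; rewrite card_ord ltnn.
  case/injectivePn=> l [l' ll' gll'].
  case: (ltngtP l l') => [?|?|/val_inj ll'E]; first by exists l, l'.
    by exists l', l.
  by rewrite ll'E eqxx in ll'.
have lM : l < M by apply: leq_trans lt_ll' _; rewrite -ltnS.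
pose L (i : 'I_M + I0) : A + 'I_n.+1 :=
  match i with
  | inl x => if x < l then inl a else if x < l' then inr ord0 else inl b
  | inr y => match L0 y with inl c => inl c | inr j => inr (lift ord0 j) end
  end.
pose tl (w : {ffun 'I_n.+1 -> A}) : {ffun 'I_n -> A} := [ffun j => w (lift ord0 j)].
have substE (w : {ffun 'I_n.+1 -> A}) : finfun (subst L w) =
    pair_words (T l (w ord0) l') (finfun (subst L0 (tl w))).
  apply/ffunP=> -[x|y]; rewrite !ffunE /subst /=.
    by case: ifP => //; case: ifP.
  by case: (L0 y) => // j; rewrite ffunE.
exists L; split=> [j|w w' j ww' wa w'b].
  case: (unliftP ord0 j) => [j' ->|->].
    by have [i Li] := L0var j'; exists (inr i); rewrite /L Li.
  by exists (inl (Ordinal lM)); rewrite /L /= ltnn lt_ll'.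
rewrite !substE; case: (unliftP ord0 j) => [j' jE|j0].
  have <- : w ord0 = w' ord0 by apply: ww'; rewrite jE neq_lift.
  pose colL0 w1 : {ffun {ffun 'I_M -> A} -> C} :=
    [ffun t : {ffun 'I_M -> A} => col (pair_words t (finfun (subst L0 (tl w1))))].
  suff /ffunP/(_ (T l (w ord0) l')) : colL0 w = colL0 w' by rewrite !ffunE.
  apply: (L0flip (tl w) (tl w') j') => [i ij||]; rewrite !ffunE -?jE //.
  by apply: ww'; rewrite jE (inj_eq lift_inj).
have -> : tl w' = tl w.
  by apply/ffunP=> i; rewrite !ffunE ww' // j0 eq_sym neq_lift.
rewrite -j0 wa w'b.
(* Giving the new variable the value [a] or [b] yields the words with [l'] or [l] letters [a], on
   which [g] agrees. *)
have Ta : T l a l' = T l' b l'.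
  apply/ffunP=> x; rewrite !ffunE; case: ifP => // xl.
    by rewrite (ltn_trans xl).
  by case: ifP.
have Tb : T l b l' = T l b l.
  by apply/ffunP=> x; rewrite !ffunE; case: ifP => //; case: ifP.
by move/ffunP/(_ (tl w)): gll'; rewrite !ffunE Ta Tb.
Qed.

(** Induction on the list [D] of letters on which the line has to be monochromatic, the alphabet
    being fixed. To add [b] to [a :: D], the line for [a :: D] is taken inside a subspace
    insensitive to changing [a] into [b]. *)
Lemma Hales_Jewett_on (A : finType) (D : seq A) (C : finType) :
  exists I : finType, forall col : {ffun I -> A} -> C,
    exists L : I -> A + unit, (exists i, L i = inr tt) /\
      {in D &, forall a b, col (finfun (subst L (fun=> a))) =
                           col (finfun (subst L (fun=> b)))}.
Proof.
elim: D C => [|b [|a D] IHD] C.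
- by exists unit => col; exists inr; split=> //; exists tt.
- exists unit => col; exists inr; split; first by exists tt.
  by move=> x y; rewrite !inE => /eqP-> /eqP->.
have [I1 HI1] := IHD C.
have [I HI] := insensitive_subspace a b #|I1| C.
exists I => col; have [L [Lvar Lflip]] := HI col.
have [L1 [[i1 L1var] L1mono]] := HI1 (fun w => col (finfun (subst L
  (fun j => w (enum_val j))))).
pose L' i := match L i with inl c => inl c | inr j => L1 (enum_val j) end.
pose line c : {ffun I1 -> A} := finfun (subst L1 (fun=> c)).
have substE c :
    finfun (subst L' (fun=> c)) = finfun (subst L (fun j => line c (enum_val j))).
  apply/ffunP=> i; rewrite !ffunE /subst /L'; case: (L i) => // j.
  by rewrite ffunE.
exists L'; split.
  have [i Li] := Lvar (enum_rank i1).
  by exists i; rewrite /L' Li enum_rankK.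
have ab : col (finfun (subst L' (fun=> a))) = col (finfun (subst L' (fun=> b))).
  rewrite !substE.
  have := @flip_invariance _ A C a b (fun w => col (finfun (subst L w))) Lflip
    [ffun j => line a (enum_val j)] [ffun j => line b (enum_val j)].
  have E c : finfun (subst L [ffun j => line c (enum_val j)])
     = finfun (subst L (fun j => line c (enum_val j))).
    by apply/ffunP=> i; rewrite !ffunE /subst; case: (L i) => // j; rewrite ffunE.
  rewrite !E; apply=> j; rewrite !ffunE /subst.
  by case: (L1 _) => [c|_]; [left | right].
have toa c : c \in b :: a :: D ->
    col (finfun (subst L' (fun=> c))) = col (finfun (subst L' (fun=> a))).
  rewrite inE => /orP[/eqP->//|cD].
  by rewrite !substE; apply: L1mono => //; rewrite inE eqxx.
by move=> x y /toa-> /toa->.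
Qed.

(** A line over the alphabet [{ffun J -> A}] becomes, once each letter is unfolded into its [J]
    coordinates, a subspace with one variable for each [j]. *)
Lemma Hales_Jewett (A J C : finType) :
  exists I : finType, forall col : {ffun I -> A} -> C,
    exists L : I -> A + J, (forall j, exists i, L i = inr j) /\
      forall w w' : {ffun J -> A},
        col (finfun (subst L w)) = col (finfun (subst L w')).
Proof.
have [I1 HI1] := Hales_Jewett_on (enum {ffun J -> A}) C.
exists (I1 * J)%type => col.
have [L1 [[i L1i] L1mono]] := HI1 (fun z => col [ffun ij => z ij.1 ij.2]).
pose L ij := match L1 ij.1 with
             | inl w => inl ((w : {ffun J -> A}) ij.2) | inr _ => inr ij.2 end.
exists L; split=> [j|w w']; first by exists (i, j); rewrite /L L1i.
have substE (u : {ffun J -> A}) : finfun (subst L u) =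
    [ffun ij => (finfun (subst L1 (fun=> u)) : {ffun _}) ij.1 ij.2].
  by apply/ffunP=> ij; rewrite !ffunE /subst /L; case: (L1 _).
by rewrite !substE; apply: L1mono; rewrite mem_enum.
Qed.

(** With [B'] the words over [B], a monochromatic line over [{ffun J -> B}] splits into one line for
    each [j], parametrized by [chi j]. The moving coordinate makes [chi j] injective. *)
Lemma product_Ramsey (B J C : finType) :
  exists B' : finType, forall col : {ffun J -> B'} -> C,
    exists chi : J -> B -> B', (forall j, injective (chi j)) /\
      forall u u' : {ffun J -> B},
        col [ffun j => chi j (u j)] = col [ffun j => chi j (u' j)].
Proof.
have [I HI] := Hales_Jewett_on (enum {ffun J -> B}) C.
exists {ffun I -> B} => col.
have [L [[i Li] Lmono]] := HI (fun z => col [ffun j => [ffun i => z i j]]).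
pose chi j c : {ffun I -> B} :=
  [ffun i => match L i with inl w => (w : {ffun J -> B}) j | inr _ => c end].
exists chi; split=> [j c c' /ffunP/(_ i)|u u']; first by rewrite !ffunE Li.
have chiE (v : {ffun J -> B}) : [ffun j => chi j (v j)] =
    [ffun j => [ffun i => (finfun (subst L (fun=> v)) : {ffun _}) i j]].
  apply/ffunP=> j; apply/ffunP=> i'; rewrite !ffunE /subst.
  by case: (L i').
by rewrite !chiE; apply: Lmono; rewrite mem_enum.
Qed.

End HalesJewett.

Local Open Scope ring_scope.

(** * Cubes in sets without independent flats *)

Section Independence.
Variables (K : fieldType) (vT : lmodType K).

Definition lin_indep (I : finType) (h : I -> vT) : Prop :=
  forall c : I -> K, \sum_i c i *: h i = 0 -> forall i, c i = 0.

(** This is linear independence of [x] together with the [h i]; in particular the affine subspace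
    through [x] with these directions avoids 0. *)
Definition affine_indep (I : finType) (x : vT) (h : I -> vT) : Prop :=
  forall (c0 : K) (c : I -> K), c0 *: x + \sum_i c i *: h i = 0 ->
    c0 = 0 /\ forall i, c i = 0.

(* The flat spanned by [k] independent vectors of [X] is independent iff [X]
   contains no combination of them with two nonzero coefficients. *)
Definition no_indep_flat (k : nat) (X : pred vT) : Prop :=
  forall y : 'I_k -> vT, (forall j, X (y j)) -> lin_indep y ->
    exists a : {ffun 'I_k -> K},
      (exists j1 j2, [/\ j1 != j2, a j1 != 0 & a j2 != 0]) /\
      X (\sum_j a j *: y j).

Definition cube (s : nat) (J : finType) (X : pred vT) : Prop :=
  exists (q : 'I_s -> K) (x : vT) (h : J -> vT),
    [/\ injective q, affine_indep x h
      & forall u : J -> 'I_s, X (x + \sum_t q (u t) *: h t)].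

(** Restricting a cube to a combinatorial subspace [L] replaces its directions by their sums over
    the fibres of [L]; here such sums are rewritten in the original directions. *)
Lemma sum_fibers (A : eqType) (I T : finType) (L : I -> A + T) (c : T -> K)
    (g : I -> vT) :
  \sum_t c t *: (\sum_(i | L i == inr t) g i) =
  \sum_i (match L i with inl _ => 0 | inr t => c t end) *: g i.
Proof.
under eq_bigr do rewrite scaler_sumr.
rewrite (exchange_big_dep xpredT) //=; apply: eq_bigr => i _.
case: (L i) => [w|t]; first by rewrite big_pred0 // scale0r.
by rewrite (big_pred1 t) // => t'; rewrite eq_sym.
Qed.

Lemma sum_affine (I J : finType) (a : J -> K) (b : J -> I -> K) x (h : I -> vT) :
  \sum_j a j *: (x + \sum_i b j i *: h i) =
  (\sum_j a j) *: x + \sum_i (\sum_j a j * b j i) *: h i.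
Proof.
under eq_bigr do rewrite scalerDr scaler_sumr.
rewrite big_split /= -scaler_suml; congr (_ + _).
rewrite exchange_big; apply: eq_bigr => i _.
by rewrite scaler_suml; apply: eq_bigr => j _; rewrite scalerA.
Qed.

Lemma extend_by_zero (I J : finType) (f : J -> I) (c : J -> K) :
  injective f -> exists d : I -> K,
    [/\ forall j, d (f j) = c j, forall i, d i != 0 -> exists j, i = f j
      & forall h : I -> vT, \sum_i d i *: h i = \sum_j c j *: h (f j)].
Proof.
move=> f_inj; pose d i := if [pick j | f j == i] is Some j then c j else 0.
have df j : d (f j) = c j.
  by rewrite /d; case: pickP => [j' /eqP/f_inj->//|/(_ j)]; rewrite eqxx.
have d_supp i : d i != 0 -> exists j, i = f j.
  by rewrite /d; case: pickP => [j /eqP<- _|_]; [exists j | rewrite eqxx].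
exists d; split=> // h.
rewrite (bigID (mem (f @: setT))) /= [X in _ + X]big1 ?addr0 => [|i fi]; last first.
  have [->|/d_supp[j ij]] := eqVneq (d i) 0; first exact: scale0r.
  by rewrite ij imset_f in fi.
rewrite big_imset /=; last by move=> ? ? _ _ /f_inj.
by apply: eq_big => [j|j _]; rewrite ?inE // df.
Qed.

Lemma lin_indep_inj (I J : finType) (h : I -> vT) (f : J -> I) :
  injective f -> lin_indep h -> lin_indep (h \o f).
Proof.
move=> f_inj h_indep c sum0 j; have [d [<- _ dE]] := extend_by_zero c f_inj.
by apply: h_indep; rewrite dE.
Qed.

End Independence.

(** * Two-letter cubes, and Ramsey's theorem for the points of a vector space *)

Section Cubes.
Variable K : finFieldType.

(** The power of ['I_k] with exponent [m]: each of [m] rounds combines [k] grids with disjoint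
    supports. *)
Fixpoint parts (k m : nat) : finType :=
  if m is m'.+1 then ('I_k * parts k m')%type else unit.

(** Induction on [m]: [k] grids on disjoint sets of vectors are combined by [no_indep_flat]. The
    coefficients depend on the points picked in the grids until [product_Ramsey] restricts the
    choices; two nonzero coefficients then double the support. *)
Lemma homogeneous_grid k m (B : finType) (b0 : B) (k_gt0 : (0 < k)%N) :
  exists B' : finType, forall (vT : lmodType K) (X : pred vT)
      (e : parts k m * B' -> vT),
    no_indep_flat k X -> lin_indep e -> (forall i, X (e i)) ->
    exists (a : parts k m -> K) (chi : parts k m -> B -> B'),
      [/\ forall t, injective (chi t), (2 ^ m <= #|[pred t | a t != 0%R]|)%N
        & forall u : parts k m -> B, X (\sum_t a t *: e (t, chi t (u t)))].
Proof.
elim: m B b0 => [|m IHm] B b0.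
  exists B => vT X e _ _ Xe; exists (fun=> 1), (fun=> id); split=> [t||u] //.
    by rewrite expn0; apply/card_gt0P; exists tt; rewrite !inE oner_eq0.
  by rewrite (big_pred1 tt) ?scale1r // => -[].
have [B1 HB1] := product_Ramsey B (parts k m.+1) {ffun 'I_k -> K}.
(* The dummy colouring only serves to exhibit an element of [B1], which the induction hypothesis
   asks for. *)
have [chi0 _] := HB1 (fun=> [ffun=> 0]).
have [t0] : inhabited (parts k m.+1).
  elim: m.+1 => [|m' [t]]; first by do 2!constructor.
  by constructor; split=> //; exact: (Ordinal k_gt0).
have [B' HB'] := IHm B1 (chi0 t0 b0).
exists B' => vT X e Xk ie Xe.
have step j : exists (a : parts k m -> K) (chi : parts k m -> B1 -> B'),
    [/\ forall t, injective (chi t), (2 ^ m <= #|[pred t | a t != 0%R]|)%N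
      & forall u : parts k m -> B1, X (\sum_t a t *: e ((j, t), chi t (u t)))].
  apply: (HB' vT X (fun tb => e ((j, tb.1), tb.2))) => //.
  by apply: (lin_indep_inj _ ie) => -[t b] [t' b'] [-> ->].
have [a /fin_all_exists[chi aP]] := fin_all_exists step.
pose y (u : {ffun parts k m.+1 -> B1}) j :=
  \sum_t a j t *: e ((j, t), chi j t (u (j, t))).
have Xy u j : X (y u j) by have [_ _ /(_ (fun t => u (j, t)))] := aP j.
(* The [y u j] involve disjoint sets of vectors [e], and each has a nonzero coefficient. *)
have iy u : lin_indep (y u).
  move=> c sum0 j; have [_ /= a_supp _] := aP j.
  have /card_gt0P[t] : (0 < #|[pred t | a j t != 0%R]|)%N.
    by apply: leq_trans a_supp; rewrite expn_gt0.
  rewrite inE => ajt; apply/eqP; rewrite -[_ == 0](orbF) -(negPf ajt) -mulf_eq0.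
  have inj_phi : injective (fun jt : parts k m.+1 => (jt, chi jt.1 jt.2 (u jt))).
    by move=> jt jt' [].
  have := lin_indep_inj inj_phi ie (c := fun jt => c jt.1 * a jt.1 jt.2).
  move=> /(_ _ (j, t)) /= ->//; rewrite -[RHS]sum0 /y.
  under [RHS]eq_bigr do rewrite scaler_sumr.
  by rewrite pair_big /=; apply: eq_bigr => -[j' t'] _ /=; rewrite scalerA.
have [b bP] := fin_all_exists (fun u => Xk (y u) (Xy u) (iy u)).
have [chi' [chi'_inj b_const]] := HB1 b.
pose c := b [ffun jt => chi' jt b0].
have bE (u : {ffun parts k m.+1 -> B}) : b [ffun jt => chi' jt (u jt)] = c.
  rewrite (b_const u [ffun=> b0]); congr b.
  by apply/ffunP=> jt; rewrite !ffunE.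
exists (fun jt => c jt.1 * a jt.1 jt.2), (fun jt => chi jt.1 jt.2 \o chi' jt).
split=> [jt|/=|u].
- by apply: inj_comp (chi'_inj jt); have [] := aP jt.1.
- have [[j1 [j2 [j12 cj1 cj2]]] _] := bP [ffun jt => chi' jt b0].
  rewrite -/c in cj1 cj2.
  rewrite -sum1_card; under eq_bigl do rewrite inE mulf_eq0 negb_or.
  rewrite -(pair_big_dep (fun j => c j != 0) (fun j t => a j t != 0) (fun _ _ => 1%N)) /=.
  rewrite (bigD1 j1) //= (bigD1 j2) /=; last by rewrite cj2 eq_sym.
  rewrite addnA expnS mul2n -addnn; apply: leq_trans (leq_addr _ _).
  by apply: leq_add; rewrite sum1_card; [have [] := aP j1 | have [] := aP j2].
have [_] := bP [ffun jt => chi' jt ((finfun u : {ffun parts k m.+1 -> B}) jt)].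
rewrite (bE (finfun u)) => Xs; congr X: Xs.
rewrite /y; under eq_bigr do rewrite scaler_sumr.
rewrite pair_big /=; apply: eq_bigr => -[j t] _ /=.
by rewrite scalerA !ffunE.
Qed.

(** A grid with two choices at each [t] is a base point, the first choice everywhere, plus
    differences of the two choices. As [#|J| < 2 ^ #|J|], enough [a t] are nonzero to give a
    direction for each element of [J]; the other positions keep the first choice. *)
Lemma cube2 k (J : finType) : (0 < k)%N ->
  exists I : finType, forall (vT : lmodType K) (X : pred vT) (e : I -> vT),
    no_indep_flat k X -> lin_indep e -> (forall i, X (e i)) -> cube 2 J X.
Proof.
move=> k_gt0; have [B HB] := homogeneous_grid #|J| (ord0 : 'I_2) k_gt0.
exists (parts k #|J| * B)%type => vT X e Xk ie Xe.
have [a [chi [chi_inj a_supp Xgrid]]] := HB vT X e Xk ie Xe.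
pose S := [set t | a t != 0].
have ltJS : (#|J| < #|S|)%N by rewrite cardsE; apply: leq_trans a_supp; apply: ltn_expl.
(* Needed even when [J] is empty, for the base point to be nonzero. *)
have [t0 at0] : exists t, a t != 0.
  have /card_gt0P[t] : (0 < #|S|)%N by apply: leq_ltn_trans ltJS.
  by rewrite inE; exists t.
pose iota s : parts k #|J| := enum_val (widen_ord (ltnW ltJS) (enum_rank s)).
have iota_inj : injective iota.
  by move=> s s' /enum_val_inj/(congr1 val)/= /val_inj/enum_rank_inj.
have a_iota s : a (iota s) != 0.
  by have := enum_valP (widen_ord (ltnW ltJS) (enum_rank s)); rewrite inE.
pose L t : unit + J := if [pick s | iota s == t] is Some s then inr s else inl tt.
have L_iota s : L (iota s) = inr s.
  rewrite /L; case: pickP => [s' /eqP/iota_inj->//|/(_ s)]; by rewrite eqxx.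
pose g t := a t *: (e (t, chi t ord_max) - e (t, chi t ord0)).
exists (fun i : 'I_2 => (i : nat)%:R), (\sum_t a t *: e (t, chi t ord0)),
  (fun s => \sum_(t | L t == inr s) g t); split.
- move=> [[|[|i]] Hi] [[|[|j]] Hj] //= /eqP E; apply: val_inj => //=.
    by rewrite eq_sym oner_eq0 in E.
  by rewrite oner_eq0 in E.
- move=> c0 c; rewrite sum_fibers scaler_sumr -big_split /=.
  pose d t := match L t with inl _ => 0 | inr s => c s end.
  (* The coordinates of the combination on the two vectors chosen at each [t], which are all
     independent since [chi t] is injective. *)
  pose C (tb : parts k #|J| * 'I_2) :=
    (if tb.2 == ord0 then c0 - d tb.1 else d tb.1) * a tb.1.
  have inj_phi : injective (fun tb : parts k #|J| * 'I_2 => (tb.1, chi tb.1 tb.2)).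
    by move=> [t b] [t' b'] [-> /chi_inj->].
  move=> sum0; have {sum0} C0 tb : C tb = 0.
    apply: (lin_indep_inj inj_phi ie (c := C)); rewrite -[RHS]sum0 /=.
    rewrite -(pair_big xpredT xpredT (fun t b => C (t, b) *: e (t, chi t b))) /=.
    apply: eq_bigr => t _; rewrite big_ord_recl big_ord1 /C /= -/(d t) /g.
    have -> : lift ord0 ord0 = ord_max :> 'I_2 by apply: val_inj.
    rewrite !scalerA scalerBr mulrBl scalerBl -addrA; congr (_ + _).
    by rewrite addrC.
  have d0 t : a t != 0 -> d t = 0.
    move=> at0'; apply/eqP; have /eqP := C0 (t, ord_max).
    by rewrite /C /= mulf_eq0 (negPf at0') orbF.
  split=> [|s].
    have /eqP := C0 (t0, ord0); rewrite /C /= mulf_eq0 (negPf at0) orbF.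
    by rewrite d0 // subr0 => /eqP.
  by have := d0 (iota s) (a_iota s); rewrite /d L_iota.
- move=> u; pose u' t := match L t with inl _ => ord0 | inr s => u s end.
  have := Xgrid u'; congr (X _); rewrite sum_fibers -big_split /=.
  apply: eq_bigr => t _; rewrite /g /u'.
  case: (L t) => [_|s]; first by rewrite scale0r addr0.
  case: (u s) => [[|[|i]] Hi] //=.
    rewrite scale0r addr0; congr (_ *: e (_, chi _ _)); exact: val_inj.
  rewrite scale1r -scalerDr addrC subrK; congr (_ *: e (_, chi _ _)); exact: val_inj.
Qed.

(** Once the leading coefficient is 1, the colour depends only on its position. Each new vector gets
    a new coordinate: Hales-Jewett makes the colour constant on a subspace of the words with value 1
    there, and induction handles the linear part of that subspace, with value 0 there. *)
Lemma leading_Ramsey (C : finType) (d : nat) :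
  exists I : finType, forall col : {ffun I -> K^o} -> C,
    exists v : 'I_d -> {ffun I -> K^o}, lin_indep v /\
      forall (i : 'I_d) (c c' : 'I_d -> K),
        (forall j : 'I_d, (j < i)%N -> c j = 0 /\ c' j = 0) -> c i = 1 -> c' i = 1 ->
        col (\sum_j c j *: v j) = col (\sum_j c' j *: v j).
Proof.
elim: d => [|d [J HJ]].
  exists void => col; exists (fun=> 0); split=> [c _ []|[]] //.
have [I0 HI0] := Hales_Jewett K^o J C.
exists (option I0) => col.
pose ext (b : K) (z : {ffun I0 -> K^o}) : {ffun option I0 -> K^o} :=
  [ffun i => if i is Some i' then z i' else b].
have [L [Lvar Lconst]] := HI0 (fun z => col (ext 1 z)).
(* The linear part of the affine map [subst L]: frozen coordinates become 0. *)
pose lin (w : {ffun J -> K^o}) : {ffun I0 -> K^o} :=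
  [ffun i => match L i with inl _ => 0 | inr j => w j end].
have [v' [v'_indep v'P]] := HJ (fun w => col (ext 0 (lin w))).
pose v (i : 'I_d.+1) : {ffun option I0 -> K^o} :=
  if unlift ord0 i is Some j then ext 0 (lin (v' j))
  else ext 1 (finfun (subst L (0 : {ffun J -> K^o}))).
have sumE (c : 'I_d.+1 -> K) : \sum_j c j *: v j =
    [ffun i => if i is Some i' then
       match L i' with inl w => c ord0 * w
       | inr t => (\sum_j c (lift ord0 j) *: v' j) t end
     else c ord0].
  apply/ffunP=> i; rewrite big_ord_recl /v unlift_none.
  under eq_bigr do rewrite liftK.
  rewrite !ffunE sum_ffunE /=; case: i => [i|]; last first.
    rewrite big1 => [|j _]; last by rewrite !ffunE scaler0.
    by rewrite addr0 [_ *: _]mulr1.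
  rewrite !ffunE /subst; case Li: (L i) => [w|t].
    rewrite big1 => [|j _]; last by rewrite !ffunE Li scaler0.
    by rewrite addr0.
  rewrite ffunE scaler0 add0r sum_ffunE; apply: eq_bigr => j _.
  by rewrite !ffunE Li.
exists v; split=> [c|i c c' cc' ci c'i].
  rewrite sumE => /ffunP sum0.
  have c0 : c ord0 = 0 by have := sum0 None; rewrite !ffunE.
  move=> i; case: (unliftP ord0 i) => [j ->|->//].
  apply: (v'_indep (fun j => c (lift ord0 j))); apply/ffunP=> t.
  by have [i' Li'] := Lvar t; have := sum0 (Some i'); rewrite !ffunE Li'.
rewrite !sumE; case: (unliftP ord0 i) => [j iE|i0].
  have i_gt0 : ((ord0 : 'I_d.+1) < i)%N by rewrite iE lift0.
  have [c0 c'0] := cc' _ i_gt0.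
  have E (b : 'I_d.+1 -> K) : b ord0 = 0 ->
      [ffun i => if i is Some i' then
         match L i' with inl w => b ord0 * w
         | inr t => (\sum_j b (lift ord0 j) *: v' j) t end
       else b ord0] = ext 0 (lin (\sum_j b (lift ord0 j) *: v' j)).
    move=> b0; apply/ffunP=> -[i'|]; rewrite !ffunE ?b0 //.
    by case: (L i') => // w; rewrite mul0r.
  rewrite !E //; apply: (v'P j); rewrite -?iE // => j' j'j.
  by apply: cc'; rewrite iE !lift0.
have E (b : 'I_d.+1 -> K) : b ord0 = 1 ->
    [ffun i => if i is Some i' then
       match L i' with inl w => b ord0 * w
       | inr t => (\sum_j b (lift ord0 j) *: v' j) t end
     else b ord0] = ext 1 (finfun (subst L (\sum_j b (lift ord0 j) *: v' j))).
  move=> b1; apply/ffunP=> -[i'|]; rewrite !ffunE ?b1 // /subst.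
  by case: (L i') => // w; rewrite mul1r.
by rewrite !E -?i0.
Qed.

(** Among [d + d] vectors given by [leading_Ramsey], some [d] have the same colour. Since the
    colouring ignores nonzero scalars, a nonzero combination of these has the colour of its leading
    vector. *)
Lemma vector_Ramsey (d : nat) :
  exists I : finType, forall col : pred {ffun I -> K^o},
    (forall c w, c != 0 -> col (c *: w) = col w) ->
    exists (b : bool) (v : 'I_d -> {ffun I -> K^o}), lin_indep v /\
      forall c : 'I_d -> K, (exists i, c i != 0) -> col (\sum_j c j *: v j) = b.
Proof.
have [I HI] := leading_Ramsey bool (d + d).
exists I => col colZ; have [v [v_indep vP]] := HI col.
pose S b := [set i | col (v i) == b].
have [b leS] : exists b, (d <= #|S b|)%N.
  have [?|ltS] := leqP d #|S true|; first by exists true.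
  exists false; rewrite -(leq_add2l #|S true|) -cardsUI.
  have -> : S true :&: S false = set0.
    by apply/setP=> i; rewrite !inE; case: (col _).
  have -> : S true :|: S false = setT.
    by apply/setP=> i; rewrite !inE; case: (col _).
  by rewrite cardsT card_ord cards0 addn0 leq_add2r ltnW.
pose iota (i : 'I_d) : 'I_(d + d) := enum_val (widen_ord leS i).
have iota_inj : injective iota by move=> i j /enum_val_inj/(congr1 val)/= /val_inj.
exists b, (v \o iota); split=> [|c [i0 ci0]]; first exact: lin_indep_inj.
have [c' [c'_iota c'_supp c'E]] := extend_by_zero {ffun I -> K^o} c iota_inj.
rewrite -[\sum_j _](c'E v).
have c'i0 : c' (iota i0) != 0 by rewrite c'_iota.
(* Dividing by the first nonzero coefficient normalizes the combination, which is then compared with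
   [v i] alone. *)
case: (arg_minnP (P := fun i => c' i != 0) val c'i0) => i c'i min_i.
rewrite -(colZ (c' i)^-1) ?invr_eq0 // scaler_sumr.
under eq_bigr do rewrite scalerA.
rewrite (vP i _ (fun j => (j == i)%:R)).
- rewrite (bigD1 i) //= eqxx scale1r big1 ?addr0 => [|j /negPf->]; last exact: scale0r.
  have [j ->] := c'_supp i c'i.
  by have := enum_valP (widen_ord leS j); rewrite inE => /eqP.
- move=> j lt_ji; split; last by case: eqP lt_ji => // ->; rewrite ltnn.
  case: (eqVneq (c' j) 0) => [->|/min_i]; first by rewrite mulr0.
  by rewrite leqNgt lt_ji.
- exact: mulVf.
- by rewrite eqxx.
Qed.

End Cubes.

(** * Enlarging the alphabet up to the whole prime field *)

Section PrimeField.
Variables (p : nat) (p_prime : prime p).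
Local Notation K := 'F_p.

(* A weak form of the Cauchy-Davenport theorem: a set of residues that is
   invariant under a nonzero translation is everything. *)
Lemma sumset_grows s (q : 'I_s -> K) (a1 a2 : K) (s0 s1 : 'I_s) :
  (s < p)%N -> injective q -> s0 != s1 -> a1 != 0 -> a2 != 0 ->
  exists u w : 'I_s.+1 -> 'I_s, injective (fun l => a1 * q (u l) + a2 * q (w l)).
Proof.
move=> lt_sp q_inj s01 a1n0 a2n0.
(* [S] supplies [s] distinct values, and any [a1 * q l + a2 * q s1] outside [S] is the extra one. If
   there is none, [S] is invariant under translation by [d]. *)
pose S := [set a1 * q l + a2 * q s0 | l : 'I_s].
have cardS : #|S| = s.
  by rewrite card_imset ?card_ord // => l l' /addIr /(mulfI a1n0) /q_inj.
have [/existsP[l lS]|] := boolP [exists l, a1 * q l + a2 * q s1 \notin S].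
  pose u i := if unlift ord_max i is Some l' then l' else l.
  pose w (i : 'I_s.+1) := if unlift ord_max i is Some _ then s0 else s1.
  exists u, w => i j; rewrite /u /w.
  case: (unliftP ord_max i) => [i' ->|->]; case: (unliftP ord_max j) => [j' ->|->] //.
  - by move/addIr/(mulfI a1n0)/q_inj->.
  - by move=> E; case/negP: lS; rewrite -E; apply: imset_f.
  - by move=> E; case/negP: lS; rewrite E; apply: imset_f.
rewrite negb_exists => /forallP closed.
pose d := a2 * (q s1 - q s0).
have d0 : d != 0.
  by rewrite mulf_neq0 // subr_eq0 (inj_eq q_inj) eq_sym.
have SD z : z \in S -> z + d \in S.
  case/imsetP=> l _ ->; have := closed l; rewrite negbK; congr (_ \in S).
  by rewrite /d mulrBr -addrA; congr (_ + _); rewrite addrC subrK.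
have SDn n z : z \in S -> z + d *+ n \in S.
  elim: n => [|n IHn] zS; first by rewrite mulr0n addr0.
  by rewrite mulrSr addrA; apply/SD/IHn.
suff ST : S = setT.
  have := cardS; rewrite ST cardsT card_Fp // => ps.
  by have := ltnn p; rewrite {1}ps lt_sp.
apply/setP=> y; rewrite inE; pose z := a1 * q s0 + a2 * q s0.
(* The residue [(y - z) / d] is read as a natural number of translations leading from [z] to [y]. *)
have := SDn ((y - z) / d : K) z; rewrite -mulr_natl natr_Zp divfK // addrC subrK.
by apply; apply: imset_f.
Qed.

Lemma cube_grows k s (J : finType) : (1 < s)%N -> (s < p)%N ->
  exists I : finType, forall (vT : lmodType K) (X : pred vT),
    no_indep_flat k X -> cube s I X -> cube s.+1 J X.
Proof.
move=> s_gt1 lt_sp.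
pose s0 : 'I_s := Ordinal (ltnW s_gt1); pose s1 : 'I_s := Ordinal s_gt1.
pose A : finType := {ffun 'I_k -> 'I_s}.
have [I0 HI0] := Hales_Jewett A J {ffun 'I_k -> K}.
exists ('I_k + I0)%type => vT X Xk [q [x [h [q_inj xh_indep Xq]]]].
(* On the [k] extra coordinates, point [j] has letter [s1] at place [j] and [s0] elsewhere; this
   makes the [k] points independent for every [W]. *)
pose delta i : A := [ffun j => if i == j then s1 else s0].
pose word (W : {ffun I0 -> A}) i := match i with inl i => delta i | inr i => W i end.
pose y W (j : 'I_k) := x + \sum_i q (word W i j) *: h i.
have delta_sum (c : 'I_k -> K) j :
    \sum_i c i * q (delta j i) = c j * (q s1 - q s0) + (\sum_i c i) * q s0.
  under eq_bigr do rewrite ffunE.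
  rewrite mulr_suml (bigD1 j) //= [in RHS](bigD1 j) //= eqxx mulrBr addrA subrK.
  by congr (_ + _); apply: eq_bigr => i /negPf ij; rewrite eq_sym ij.
have coef0 (c : K) : c * (q s1 - q s0) = 0 -> c = 0.
  by move/eqP; rewrite mulf_eq0 subr_eq0 (inj_eq q_inj) orbF => /eqP.
have y_indep W : lin_indep (y W).
  move=> c; rewrite sum_affine => /xh_indep[c_sum c_word] j.
  by apply: coef0; have := c_word (inl j); rewrite delta_sum c_sum mul0r addr0.
have [a aP] := fin_all_exists (fun W => Xk (y W) (fun j => Xq _) (y_indep W)).
have [L [Lvar a_const]] := HI0 a.
pose b := a (finfun (subst L (fun=> [ffun=> s0]))).
have aE (w : J -> A) : a (finfun (subst L w)) = b.
  have := a_const (finfun w) [ffun=> [ffun=> s0]]; congr (a _ = a _).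
    by apply/ffunP=> i; rewrite !ffunE /subst; case: (L i) => // t; rewrite ffunE.
  by apply/ffunP=> i; rewrite !ffunE /subst; case: (L i) => // t; rewrite ffunE.
have [[j1 [j2 [j12 bj1 bj2]]] _] := aP (finfun (subst L (fun=> [ffun=> s0]))).
rewrite -/b in bj1 bj2.
have s01 : s0 != s1 by [].
have [u [w uw_inj]] := sumset_grows lt_sp q_inj s01 bj1 bj2.
pose rest := \sum_(j | (j != j1) && (j != j2)) b j * q s0.
(* Placing [u l] at [j1] and [w l] at [j2] makes the [s.+1] values of [q'] distinct; the other
   places add the common shift [rest]. *)
pose letter l : A := [ffun j => if j == j1 then u l else if j == j2 then w l else s0].
pose q' l := \sum_j b j * q (letter l j).
have q'E l : q' l = (b j1 * q (u l) + b j2 * q (w l)) + rest.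
  rewrite /q' (bigD1 j1) //= (bigD1 j2) 1?eq_sym //= -addrA; congr (_ + (_ + _)).
  - by rewrite ffunE eqxx.
  - by rewrite ffunE eqxx eq_sym (negPf j12).
  - by apply: eq_bigr => j /andP[/negPf jj1 /negPf jj2]; rewrite ffunE jj1 jj2.
pose L' i := match i with inl i => inl (delta i) | inr i => L i end.
pose fixed (i : 'I_k + I0) : K :=
  match L' i with inl v => \sum_j b j * q ((v : A) j) | inr _ => 0 end.
exists q', ((\sum_j b j) *: x + \sum_i fixed i *: h i),
  (fun t => \sum_(i | L' i == inr t) h i); split.
- by move=> l l'; rewrite !q'E => /addIr /uw_inj.
- move=> c0 c; rewrite sum_fibers scalerDr scaler_sumr -addrA -big_split /=.
  under [X in _ + X]eq_bigr do rewrite scalerA -scalerDl.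
  rewrite scalerA => /xh_indep[c0b c_fixed].
  have c0_0 : c0 = 0.
    (* If the [b j] sum to 0, then [x] drops out of the new base point, but its coefficient at the
       extra coordinate [inl j1] is [b j1 * (q s1 - q s0)], which is nonzero. *)
    apply/eqP; apply: contraTT isT => c0n0.
    have b0 : \sum_j b j = 0.
      by apply/eqP; move/eqP: c0b; rewrite mulf_eq0 (negPf c0n0).
    have := c_fixed (inl j1); rewrite /fixed /= addr0 delta_sum b0 mul0r addr0.
    by move/eqP; rewrite mulf_eq0 (negPf c0n0) => /eqP/coef0/eqP; rewrite (negPf bj1).
  split=> // t; have [i Li] := Lvar t; have := c_fixed (inr i).
  by rewrite /= Li c0_0 mul0r add0r.
move=> v; pose W := finfun (subst L (fun t => letter (v t))).
have [_] := aP W; rewrite /W aE -/W => XW; congr (X _): XW.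
rewrite /y sum_affine sum_fibers -addrA -big_split /=; congr (_ + _).
apply: eq_bigr => i _; rewrite -scalerDl; congr (_ *: _).
rewrite /fixed; case: i => [i|i] /=; first by rewrite addr0.
under eq_bigr do rewrite ffunE /subst.
by case: (L i) => [z|t]; rewrite ?addr0 ?add0r.
Qed.

Lemma full_cube k (J : finType) : (0 < k)%N ->
  exists I : finType, forall (vT : lmodType K) (X : pred vT) (e : I -> vT),
    no_indep_flat k X -> lin_indep e -> (forall i, X (e i)) -> cube p J X.
Proof.
move=> k_gt0.
suff cube_n n : (2 + n <= p)%N -> forall J : finType,
    exists I : finType, forall (vT : lmodType K) (X : pred vT) (e : I -> vT),
    no_indep_flat k X -> lin_indep e -> (forall i, X (e i)) -> cube (2 + n) J X.
  by have := cube_n (p - 2)%N; rewrite subnKC ?prime_gt1 //; apply.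
elim: n => [|n IHn] lt_np {}J; first by rewrite addn0; apply: cube2.
rewrite addnS in lt_np *.
have [I0 HI0] := @cube_grows k (2 + n) J isT lt_np.
have [I HI] := IHn (ltnW lt_np) I0.
by exists I => vT X e Xk ie Xe; exact: HI0 Xk (HI _ _ _ Xk ie Xe).
Qed.

(** A combination with nonzero coefficient sum is a multiple of a point of the affine subspace,
    hence in [X]. A nontrivial one with sum 0 is a nonzero direction, and [vector_Ramsey] gives all
    of these the same status [beta]. *)
Lemma affine_or_projective_span k : (0 < k)%N ->
  exists I : finType, forall (vT : lmodType K) (X : pred vT) (e : I -> vT),
    (forall c w, c != 0 -> X (c *: w) = X w) ->
    no_indep_flat k X -> lin_indep e -> (forall i, X (e i)) ->
    exists (beta : bool) (b : 'I_k -> vT), lin_indep b /\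
      forall c : 'I_k -> K, (exists i, c i != 0) ->
        X (\sum_i c i *: b i) = (\sum_i c i != 0) || beta.
Proof.
case: k => // k k_gt0; have [J HJ] := vector_Ramsey K k.
have [I HI] := full_cube J k_gt0.
exists I => vT X e XZ Xk ie Xe.
have [q [x [h [q_inj xh_indep Xq]]]] := HI vT X e Xk ie Xe.
have Xaff (c : J -> K) : X (x + \sum_t c t *: h t).
  (* An injective [q] on [p] letters is onto ['F_p], so the cube is a whole affine subspace. *)
  have [g _ gK] : bijective q by apply: inj_card_bij; rewrite // card_Fp ?card_ord.
  have := Xq (g \o c); congr (X (_ + _)).
  by apply: eq_bigr => t _; rewrite /= gK.
have [|beta [v [v_indep vP]]] := HJ (fun c => X (\sum_t c t *: h t)).
  move=> c w c0; rewrite -[RHS](XZ c) // scaler_sumr; congr (X _).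
  by apply: eq_bigr => t _; rewrite scalerA !ffunE.
(* The first [b i] is [x] itself; the others are [x] translated by the directions that the [v j]
   encode. *)
pose b i := x + \sum_t (if unlift ord0 i is Some j then v j t else 0) *: h t.
have bE (c : 'I_k.+1 -> K) : \sum_i c i *: b i = (\sum_i c i) *: x +
    \sum_t (\sum_j c (lift ord0 j) *: v j) t *: h t.
  rewrite sum_affine; congr (_ + _); apply: eq_bigr => t _; congr (_ *: _).
  rewrite big_ord_recl unlift_none mulr0 add0r sum_ffunE.
  by apply: eq_bigr => j _; rewrite liftK !ffunE.
exists beta, b; split=> [c|c [i0 ci0]].
  rewrite bE => /xh_indep[c_sum cv0].
  have c0 j : c (lift ord0 j) = 0.
    by apply: (v_indep (fun j => c (lift ord0 j))); apply/ffunP=> t; rewrite cv0 ffunE.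
  move=> i; case: (unliftP ord0 i) => [j ->|->] //.
  by move: c_sum; rewrite big_ord_recl big1 ?addr0.
rewrite bE; have [sum0|sum_neq0] /= := eqVneq (\sum_i c i) 0.
  rewrite sum0 scale0r add0r; apply: vP; apply/existsP.
  apply: contraT; rewrite negb_exists => /forallP c0.
  have {}c0 j : c (lift ord0 j) = 0 by have := c0 j; rewrite negbK => /eqP.
  case/eqP: ci0; case: (unliftP ord0 i0) => [j ->|->] //.
  by move: sum0; rewrite big_ord_recl big1 ?addr0.
rewrite -(XZ (\sum_i c i)^-1) ?invr_eq0 // scalerDr scalerA mulVf // scale1r.
rewrite scaler_sumr; under [X in _ + X]eq_bigr do rewrite scalerA.
exact: Xaff.
Qed.

End PrimeField.

(** * Matroids represented by vectors *)

Section VectorFamilies.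
Variable K : fieldType.

Lemma vector_indep_enum (vT : vectType K) (E : finType) (f : E -> vT) (S : {set E}) :
  reflect (lin_indep (fun i : 'I_#|S| => f (enum_val i))) (vector_indep f S).
Proof.
pose t := map_tuple f (enum_tuple (mem S)).
have t_nth (i : 'I_#|S|) : t`_i = f (enum_val i).
  rewrite -[t`_i]/([seq f x | x <- enum S]`_i).
  by rewrite (nth_map (enum_val i)) -?cardE // -enum_val_nth.
have -> : vector_indep f S = free t by [].
apply: (iffP (freeP (X := t))) => t_free c sum0 i; apply: t_free.
  by rewrite -[RHS]sum0; apply: eq_bigr => j _; rewrite t_nth.
by rewrite -[RHS]sum0; apply: eq_bigr => j _; rewrite t_nth.
Qed.

Lemma vector_indepP (vT : vectType K) (E : finType) (f : E -> vT) (S : {set E}) :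
  reflect (forall c : E -> K, \sum_(x in S) c x *: f x = 0 ->
             forall x, x \in S -> c x = 0)
          (vector_indep f S).
Proof.
apply: (iffP (vector_indep_enum f S)) => [f_indep c|f_indep c sum0 i].
  rewrite (big_enum_val (fun x => c x *: f x)) => sum0 x xS.
  by rewrite -(enum_rankK_in xS xS); apply: (f_indep (fun i => c (enum_val i))).
pose d x := c (enum_rank_in (enum_valP i) x).
have dE j : d (enum_val j) = c j by rewrite /d enum_valK_in.
rewrite -dE; apply: f_indep (enum_valP i).
rewrite (big_enum_val (fun x => d x *: f x)) -[RHS]sum0.
by apply: eq_bigr => j _; rewrite dE.
Qed.

Lemma vector_indep_imset (vT : vectType K) (E1 E2 : finType) (g : E1 -> E2)
    (f : E2 -> vT) (S : {set E1}) :
  injective g -> vector_indep f (g @: S) = vector_indep (f \o g) S.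
Proof.
move=> g_inj; rewrite /vector_indep.
rewrite [[seq (f \o g) x | x <- _]](map_comp f g).
apply/perm_free/perm_map/uniq_perm.
- exact: enum_uniq.
- by rewrite map_inj_uniq ?enum_uniq.
move=> y; rewrite mem_enum; apply/imsetP/mapP=> -[x xS ->]; exists x => //.
  by rewrite mem_enum.
by rewrite -mem_enum.
Qed.

(** Multiplying coefficients by [c x] turns linear relations among the [g x] into relations among
    the [f x]. *)
Lemma vector_indep_transfer (vT wT : vectType K) (E : finType) (f : E -> vT)
    (g : E -> wT) (c : E -> K) (phi : {linear vT -> wT}) (S : {set E}) :
  injective phi -> (forall x, x \in S -> c x != 0) ->
  (forall x, x \in S -> g x = c x *: phi (f x)) ->
  vector_indep g S = vector_indep f S.
Proof.
move=> phi_inj c0 gE.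
have sumE d : \sum_(x in S) d x *: g x = phi (\sum_(x in S) (d x * c x) *: f x).
  rewrite linear_sum; apply: eq_bigr => x xS.
  by rewrite linearZ gE // scalerA.
apply/vector_indepP/vector_indepP=> [g_indep d sum0 x xS|f_indep d].
  suff /eqP : d x / c x = 0.
    by rewrite mulf_eq0 invr_eq0 (negPf (c0 x xS)) orbF => /eqP.
  apply: (g_indep (fun x => d x / c x)) => //.
  rewrite sumE [X in phi X](_ : _ = 0) ?linear0 // -[RHS]sum0.
  by apply: eq_bigr => y yS; rewrite divfK ?c0.
rewrite sumE => /eqP; rewrite -[X in _ == X](linear0 phi) (inj_eq phi_inj) => /eqP sum0 x xS.
have /eqP := f_indep _ sum0 x xS.
by rewrite mulf_eq0 (negPf (c0 x xS)) orbF => /eqP.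
Qed.

End VectorFamilies.

(** * Rank, flats and simplicity in terms of a vector representation *)

Section Representation.
Variables (K : fieldType) (vT : vectType K) (E : finType) (f : E -> vT).
Variable (M : matroid E).
Hypothesis indepM : forall S, indep M S = vector_indep f S.
Implicit Types (S F : {set E}) (W : {vspace vT}).

Definition span_of S : {vspace vT} := <<[seq f x | x <- enum S]>>%VS.

Lemma mem_span_of S x : x \in S -> f x \in span_of S.
Proof. by move=> xS; apply/memv_span/map_f; rewrite mem_enum. Qed.

Lemma span_of_subv S W : (forall x, x \in S -> f x \in W) -> (span_of S <= W)%VS.
Proof.
move=> SW; apply/span_subvP=> _ /mapP[x + ->].
by rewrite mem_enum; apply: SW.
Qed.

(** A largest independent subset of [S] spans it: an element of [S] outside the span could be
    added. *)
Lemma rk_dim S : rk M S = \dim (span_of S).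
Proof.
have dim_indep I : indep M I -> #|I| = \dim (span_of I).
  by rewrite indepM => /eqP; rewrite size_map -cardE.
apply/eqP; rewrite eqn_leq; apply/andP; split.
  apply/bigmax_leqP=> I /andP[/subsetP IS iI]; rewrite dim_indep //.
  by apply/dimvS/span_of_subv=> x /IS; apply: mem_span_of.
have P0 : (set0 \subset S) && indep M set0 by rewrite sub0set indep0.
case: (arg_maxnP (P := fun I : {set E} => (I \subset S) && indep M I)
  (fun I : {set E} => #|I|) P0) => I /andP[IS iI] maxI.
have : (#|I| <= rk M S)%N.
  by apply: (bigmax_sup I); rewrite ?IS.
apply: leq_trans; rewrite dim_indep //; apply/dimvS/span_of_subv=> x xS.
have [/mem_span_of//|xI] := boolP (x \in I).
apply: contraT => fx.
have := maxI (x |: I); rewrite subUset sub1set xS IS /= indepM vector_indepU1 //.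
by rewrite fx -indepM iI cardsU1 xI ltnn => /(_ isT).
Qed.

(** An element that does not raise the rank of the set lies in its span, which is [W]. *)
Lemma span_flat W : (W <= span_of [set x | f x \in W])%VS ->
  flat M [set x | f x \in W] /\ rk M [set x | f x \in W] = \dim W.
Proof.
set F := [set x | f x \in W] => sWF.
have spanF : span_of F = W.
  by apply/eqP; rewrite eqEsubv sWF andbT; apply: span_of_subv => x; rewrite inE.
split; last by rewrite rk_dim spanF.
apply/eqP/setP=> x; rewrite [LHS]inE !rk_dim; apply/eqP/idP=> [dimE|xF].
  have sFx : (span_of F <= span_of (x |: F))%VS.
    by apply: span_of_subv => y yF; apply: mem_span_of; rewrite inE yF orbT.
  have eq_span : span_of F = span_of (x |: F).
    by apply/eqP; rewrite eqEdim sFx dimE leqnn.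
  by rewrite inE -spanF eq_span mem_span_of ?setU11.
by rewrite (setUidPr _) // sub1set.
Qed.

Lemma card_le_rk_indep F : (#|F| <= rk M F)%N -> indep M F.
Proof.
pose P := fun I : {set E} => (I \subset F) && indep M I.
have P_gt0 : (0 < #|P|)%N by apply/card_gt0P; exists set0; rewrite unfold_in /P sub0set indep0.
have [I /andP[IF iI] rkE] := eq_bigmax_cond (fun I : {set E} => #|I|) P_gt0.
rewrite (rkE : rk M F = #|I|) => leFI.
suff /eqP<- : I == F by [].
by rewrite eqEcard IF.
Qed.

Hypothesis simpleM : simple M.

Lemma simple_neq0 x : f x != 0.
Proof.
have /andP[/forallP/(_ x)] := simpleM.
by rewrite negbK indepM /vector_indep enum_set1 seq1_free.
Qed.

Lemma simple_scale x y (c : K) : f x = c *: f y -> x = y.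
Proof.
move=> fxy; apply/eqP; apply: contraT => xy.
have /andP[_ /forallP/(_ x)/forallP/(_ y)] := simpleM.
have /andP[/forallP nl _] := simpleM.
rewrite /parallel xy !nl /= negbK indepM => /vector_indepP.
move=> /(_ (fun z => if z == x then 1 else - c)) /(_ _ x).
rewrite eqxx !inE eqxx /= => H; have /eqP : (1 : K) = 0; last by rewrite oner_eq0.
apply: H => //; rewrite big_setU1 ?inE //= big_set1 eqxx eq_sym (negPf xy).
by rewrite scale1r scaleNr fxy subrr.
Qed.

End Representation.

Section Points.
Variables (K : finFieldType) (vT : vectType K) (E : finType) (f : E -> vT).

(** The set [X] to which the results on cubes are applied; taking all nonzero multiples makes
    membership a property of projective points. *)
Definition element_vector : pred vT :=
  fun v => [exists x, exists c : K, (c != 0) && (v == c *: f x)].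

Lemma element_vectorP v :
  reflect (exists x (c : K), c != 0 /\ v = c *: f x) (element_vector v).
Proof.
apply: (iffP existsP) => [[x /existsP[c /andP[c0 /eqP->]]]|[x [c [c0 ->]]]].
  by exists x, c.
by exists x; apply/existsP; exists c; rewrite c0 eqxx.
Qed.

Lemma element_vectorZ (c : K) v : c != 0 -> element_vector (c *: v) = element_vector v.
Proof.
move=> c0; apply/element_vectorP/element_vectorP=> -[x [d [d0 E']]].
  exists x, (c^-1 * d); rewrite mulf_neq0 ?invr_eq0 //; split=> //.
  by rewrite -scalerA -E' scalerA mulVf // scale1r.
by exists x, (c * d); rewrite mulf_neq0 // E' scalerA.
Qed.

Lemma element_vector_elt x : element_vector (f x).
Proof. by apply/element_vectorP; exists x, 1; rewrite oner_eq0 scale1r. Qed.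

End Points.

Lemma representable_vectors (K : fieldType) (E : finType) (M : matroid E) :
  representable K M ->
  exists (n : nat) (f : E -> 'rV[K]_n), forall S, indep M S = vector_indep f S.
Proof.
case=> n [E' [f [g /bij_inj g_inj gE]]]; exists n, (f \o g) => S.
by rewrite -gE /= vector_indep_imset.
Qed.

(** * Coordinates on the span of an independent family *)

Section RowSpan.
Variables (K : fieldType) (n k : nat) (b : 'I_k -> 'rV[K]_n).
Hypothesis b_indep : lin_indep b.

Definition row_comb : {linear 'rV[K]_k -> 'rV[K]_n} := mulmxr (\matrix_i b i).

Lemma row_combE r : row_comb r = \sum_i r 0 i *: b i.
Proof.
by rewrite /= mulmx_sum_row; apply: eq_bigr => i _; rewrite rowK.
Qed.

Lemma row_comb_inj : injective row_comb.
Proof.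
apply: raddf_inj => r /(etrans (esym (row_combE r)))/b_indep r0.
by apply/rowP=> i; rewrite r0 mxE.
Qed.

Definition row_span : {vspace 'rV[K]_n} := limg (linfun row_comb).

Lemma row_spanP v : reflect (exists r, v = row_comb r) (v \in row_span).
Proof.
apply: (iffP (memv_imgP)) => [[r _ ->]|[r ->]]; exists r; rewrite ?lfunE //.
exact: memvf.
Qed.

Lemma dim_row_span : \dim row_span = k.
Proof.
rewrite limg_dim_eq; first by rewrite dimvf dim_matrix mul1r.
apply/eqP; rewrite -subv0; apply/subvP=> r; rewrite memv_cap memv_ker lfunE.
by rewrite memv0 -(linear0 row_comb) (inj_eq row_comb_inj) => /andP[].
Qed.

Lemma mem_row_span i : b i \in row_span.
Proof.
apply/row_spanP; exists (delta_mx 0 i).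
by rewrite /= -rowE rowK.
Qed.

End RowSpan.

Section RowMatroid.
Variables (K : finFieldType) (n k : nat) (E : finType) (f : E -> 'rV[K]_n).
Variable (M : matroid E).
Hypothesis indepM : forall S, indep M S = vector_indep f S.
Hypothesis simpleM : simple M.

(** Each [b i] is a multiple of the vector of an element, so the elements lying in [row_span b] span
    it. *)
Lemma row_span_flat (b : 'I_k -> 'rV[K]_n) :
  lin_indep b -> (forall i, element_vector f (b i)) ->
  flat M [set x | f x \in row_span b] /\ rk M [set x | f x \in row_span b] = k.
Proof.
move=> b_indep Xb; rewrite -[X in _ /\ _ = X](dim_row_span b_indep).
apply: span_flat => //; apply/subvP=> _ /row_spanP[r ->].
rewrite row_combE; apply: memv_suml => i _; apply: memvZ.
have /element_vectorP[x [c [c0 bE]]] := Xb i.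
rewrite bE; apply/memvZ/mem_span_of; rewrite inE.
by have := mem_row_span b i; rewrite bE rpredZeq (negPf c0).
Qed.

(** The flat spanned by [y] has rank [k] and is dependent, so it has an element besides those
    underlying the [y j]. By simplicity its vector is nonzero and not a multiple of any [y j], hence
    has two nonzero coefficients. *)
Lemma no_indep_flat_vectors :
  (forall F, flat M F -> rk M F = k -> ~~ indep M F) ->
  no_indep_flat k (element_vector f).
Proof.
move=> no_flat y Xy y_indep.
have [flatF rkF] := row_span_flat y_indep Xy; set F := [set x | _] in flatF rkF.
have yE j : exists x, exists c : K, c != 0 /\ y j = c *: f x by apply/element_vectorP/Xy.
have [e /fin_all_exists[c ecP]] := fin_all_exists yE.
have [x xF xe] : exists2 x, x \in F & x \notin [set e j | j : 'I_k].
  apply/subsetPn; apply: contra (no_flat F flatF rkF) => Fe.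
  apply: card_le_rk_indep; rewrite rkF; apply: leq_trans (subset_leq_card Fe) _.
  by rewrite -[X in (_ <= X)%N]card_ord; apply: leq_imset_card.
move: (xF); rewrite inE => /row_spanP[r]; rewrite row_combE => fxE.
exists [ffun j => r 0 j]; split; last first.
  by under eq_bigr do rewrite ffunE; rewrite -fxE element_vector_elt.
have [j1 rj1] : exists j, r 0 j != 0.
  apply/existsP; apply: contraT; rewrite negb_exists => /forallP r0.
  case/eqP: (simple_neq0 indepM simpleM x); rewrite fxE big1 // => j _.
  by have := r0 j; rewrite negbK => /eqP->; rewrite scale0r.
have [/existsP[j2 /andP[j21 rj2]]|] := boolP [exists j, (j != j1) && (r 0 j != 0)].
  by exists j1, j2; rewrite !ffunE eq_sym.
rewrite negb_exists => /forallP r0; case/negP: xe.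
have [c0 yj1] := ecP j1.
suff -> : x = e j1 by apply: imset_f.
apply: (simple_scale indepM simpleM (c := r 0 j1 * c j1)).
rewrite fxE (bigD1 j1) //= big1 ?addr0 => [|j jj1]; last first.
  by have := r0 j; rewrite jj1 negbK => /eqP->; rewrite scale0r.
by rewrite yj1 scalerA.
Qed.

End RowMatroid.

(** * Vector representatives and a hyperplane of the projective geometry *)

Section ProjectivePoints.
Variables (K : finFieldType) (k : nat).
Implicit Types U : point K k.

Definition rep U : 'rV[K]_k := vpick (val U).

Lemma rep_neq0 U : rep U != 0.
Proof. by rewrite /rep vpick0 -dimv_eq0 (eqP (valP U)). Qed.

Lemma rep_line U : <[rep U]>%VS = val U.
Proof.
apply/eqP; rewrite eqEdim -memvE memv_pick dim_vline rep_neq0.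
by rewrite (eqP (valP U)).
Qed.

Lemma rep_scale U U' (c : K) : rep U = c *: rep U' -> U = U'.
Proof.
move=> UU'; apply/val_inj/eqP; rewrite -!rep_line eqEdim !dim_vline !rep_neq0.
by rewrite andbT -memvE UU' memvZ // memv_line.
Qed.

Lemma exists_rep (r : 'rV[K]_k) : r != 0 -> exists U (c : K), c != 0 /\ r = c *: rep U.
Proof.
move=> r0; have dim1 : \dim <[r]> == 1%N by rewrite dim_vline r0.
pose U : point K k := exist _ <[r]>%VS dim1; exists U.
have : r \in <[rep U]>%VS by rewrite rep_line memv_line.
case/vlineP=> c rE; exists c; split=> //.
by apply: contraNneq r0 => c0; rewrite rE c0 scale0r.
Qed.

Lemma indep_PG S : indep (PG K k) S = vector_indep rep S.
Proof. exact: pg_indepE. Qed.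

Lemma PG_flat (W : {vspace 'rV[K]_k}) :
  flat (PG K k) [set U | rep U \in W] /\ rk (PG K k) [set U | rep U \in W] = \dim W.
Proof.
apply: (span_flat indep_PG); apply/subvP=> r rW.
have [->|/exists_rep[U [c [c0 rE]]]] := eqVneq r 0; first exact: mem0v.
rewrite rE; apply/memvZ/mem_span_of; rewrite inE.
by move: rW; rewrite rE rpredZeq (negPf c0).
Qed.

Lemma rank_PG : rank (PG K k) = k.
Proof.
have [_] := PG_flat fullv; rewrite dimvf dim_matrix mul1r => rkT.
rewrite -[RHS]rkT; congr (rk _ _); apply/setP=> U.
by rewrite !inE memvf.
Qed.

(** The linear form is the one that decides membership in [affine_or_projective_span]; its vanishing
    does not depend on the representative chosen. *)
Definition zero_sum : {set point K k} := [set U | \sum_i rep U 0 i == 0].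

(** The kernel of a linear form has codimension 1 when the form is nonzero, as a unit vector shows
    here. *)
Lemma zero_sum_hyperplane : (0 < k)%N -> hyperplane (PG K k) zero_sum.
Proof.
move=> k_gt0; pose s := linfun (mulmxr (const_mx 1 : 'cV[K]_k) : 'rV[K]_k -> 'rV[K]_1).
have sE r : s r 0 0 = \sum_i r 0 i.
  by rewrite lfunE /= mxE; apply: eq_bigr => i _; rewrite mxE mulr1.
have -> : zero_sum = [set U | rep U \in lker s].
  apply/setP=> U; rewrite !inE memv_ker -sE; apply/eqP/eqP=> [s0|->]; last by rewrite mxE.
  by apply/rowP=> i; rewrite ord1 s0 mxE.
have [flatH rkH] := PG_flat (lker s).
rewrite /hyperplane flatH rkH rank_PG /=.
have := limg_ker_dim s fullv; rewrite capfv dimvf dim_matrix mul1r => dim_s.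
rewrite -[X in _ == X]dim_s.
suff -> : \dim (limg s) = 1%N by rewrite addn1.
apply/eqP; rewrite eqn_leq; apply/andP; split.
  by apply: leq_trans (dimvS (subvf _)) _; rewrite dimvf dim_matrix.
rewrite lt0n dimv_eq0; apply/eqP=> s0.
have : s (delta_mx 0 (Ordinal k_gt0)) \in limg s by rewrite memv_img // memvf.
rewrite s0 memv0 => /eqP/rowP/(_ 0); rewrite sE mxE => /eqP.
rewrite (bigD1 (Ordinal k_gt0)) //= big1 ?addr0 => [|i i0].
  by rewrite mxE !eqxx oner_eq0.
by rewrite mxE (negPf i0) andbF.
Qed.

End ProjectivePoints.

(** [G] sends an element to the line of its coordinates in the basis [b]. It is injective because
    [M] is simple, so the restriction of [M] to [F] is that of the projective geometry to [P]. *)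
Lemma restr_points (K : finFieldType) (n k : nat) (E : finType)
    (f : E -> 'rV[K]_n) (M : matroid E) (b : 'I_k -> 'rV[K]_n)
    (P : {set point K k}) (F := [set x | f x \in row_span b]) :
  (forall S, indep M S = vector_indep f S) -> simple M -> lin_indep b ->
  (forall U, element_vector f (row_comb b (rep U)) = (U \in P)) ->
  exists G : {x : E | x \in F} -> point K k,
    [/\ injective G, forall x, G x \in P, forall U, U \in P -> exists x, G x = U
      & forall S : {set {x : E | x \in F}}, pg_indep (G @: S) = indep (restr M F) S].
Proof.
move=> indepM simpleM b_indep PE.
have fE (x : {x : E | x \in F}) : exists U, exists c : K,
    c != 0 /\ f (val x) = c *: row_comb b (rep U).
  have := valP x; rewrite inE => /row_spanP[r fx].
  have r0 : r != 0.
    by apply: contraNneq (simple_neq0 indepM simpleM (val x)) => r0; rewrite fx r0 linear0.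
  by have [U [c [c0 rE]]] := exists_rep r0; exists U, c; rewrite fx rE linearZ.
have [G /fin_all_exists[c GP]] := fin_all_exists fE.
have G_inj : injective G.
  move=> x y Gxy; have [[cx fx] [cy fy]] := (GP x, GP y); apply/val_inj.
  apply: (simple_scale indepM simpleM (c := c x / c y)).
  by rewrite fx fy Gxy scalerA divfK.
exists G; split=> // [x|U|S].
- have [cx fx] := GP x.
  by rewrite -PE -(element_vectorZ _ _ cx) -fx element_vector_elt.
- rewrite -PE => /element_vectorP[x [d [d0 Ux]]].
  have xF : x \in F.
    have : row_comb b (rep U) \in row_span b by apply/row_spanP; exists (rep U).
    by rewrite inE Ux rpredZeq (negPf d0).
  pose x' : {x : E | x \in F} := exist _ x xF; exists x'.
  have [cx fx] := GP x'; apply/esym/(rep_scale (c := d * c x'))/(row_comb_inj b_indep).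
  by rewrite Ux [f x]fx [RHS]linearZ; apply: scalerA.
rewrite /= /restr_indep indepM pg_indepE.
rewrite (vector_indep_imset _ _ val_inj) (vector_indep_imset _ _ G_inj).
apply/esym/(vector_indep_transfer (c := c) (row_comb_inj b_indep)) => x _ /=.
  by have [] := GP x.
by have [] := GP x.
Qed.

Lemma bijective_of_surj (T1 T2 : finType) (g : T1 -> T2) :
  injective g -> (forall y, exists x, g x = y) -> bijective g.
Proof.
by move=> g_inj /fin_all_exists[h gh]; exists h => // x; apply: g_inj.
Qed.

Local Close Scope ring_scope.

Theorem theorem1p2 (p k : nat) (p_prime : prime p) (k_gt0 : 0 < k) :
  exists N : nat,
    forall (E : finType) (M : matroid E),
      simple M -> representable 'F_p M -> N <= rank M ->
      exists F : {set E},
        [/\ flat M F, rk M F = k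
          & [\/ indep M F,
                exists2 H : {set point 'F_p k}, hyperplane (PG 'F_p k) H
                  & isomorphic (restr M F) (AG H)
              | isomorphic (restr M F) (PG 'F_p k)]].
Proof.
have [I HI] := affine_or_projective_span p_prime k_gt0.
(* This rank provides an independent set large enough to contain a family indexed by [I]. *)
exists #|I| => E M simpleM /representable_vectors[n [f indepM]] rankM.
have [/existsP[F /and3P[flatF /eqP rkF iF]]|] :=
  boolP [exists F : {set E}, [&& flat M F, rk M F == k & indep M F]].
  by exists F; split=> //; constructor 1.
rewrite negb_exists => /forallP no_flat.
have Xk : no_indep_flat k (element_vector f).
  apply: (no_indep_flat_vectors indepM simpleM) => F flatF rkF.
  by have := no_flat F; rewrite flatF rkF eqxx.
have [B iB cardB] : exists2 B : {set E}, indep M B & #|I| <= #|B|.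
  have [|B /andP[_ iB] rkE] := @eq_bigmax_cond _
    [pred B : {set E} | (B \subset setT) && indep M B] (fun B : {set E} => #|B|).
    by apply/card_gt0P; exists set0; rewrite inE sub0set indep0.
  by exists B => //; apply: leq_trans rankM _; rewrite -rkE.
pose e (i : I) := f (enum_val (widen_ord cardB (enum_rank i))).
have e_indep : lin_indep e.
  move: iB; rewrite indepM => /vector_indep_enum.
  apply: (lin_indep_inj (f := fun i => widen_ord cardB (enum_rank i))).
  by move=> i j /(congr1 val)/= /val_inj/enum_rank_inj.
have [beta [b [b_indep XE]]] := HI _ _ e (fun c w => @element_vectorZ _ _ _ f c w) Xk e_indep
  (fun i => element_vector_elt f _).
pose P := [set U : point 'F_p k | (\sum_i rep U 0 i != 0)%R || beta].
have PE U : element_vector f (row_comb b (rep U)) = (U \in P).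
  rewrite row_combE XE ?inE //; apply/existsP; apply: contraT.
  rewrite negb_exists => /forallP U0; case/eqP: (rep_neq0 U).
  by apply/rowP=> i; rewrite mxE; have := U0 i; rewrite negbK => /eqP.
have [G [G_inj GP G_surj G_indep]] := restr_points indepM simpleM b_indep PE.
(* Unit coefficients have sum 1, so [b i] is in the set whatever [beta] is. *)
have Xb i : element_vector f (b i).
  pose c j : 'F_p := ((j == i)%:R)%R.
  have c_out j : j != i -> c j = 0%R by rewrite /c => /negPf->.
  have ci : c i = 1%R by rewrite /c eqxx.
  have := XE c; rewrite (bigD1 i) //= ci scale1r big1 => [|j /c_out->]; last first.
    by rewrite scale0r.
  rewrite (bigD1 i) //= ci big1 => [|j /c_out->//]; rewrite !addr0 oner_eq0; apply.
  by exists i; rewrite ci oner_eq0.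
have [flatF rkF] := row_span_flat indepM b_indep Xb.
exists [set x | f x \in row_span b]; split=> //.
(* If [beta] holds, [P] consists of all points; otherwise it is the complement of [zero_sum]. *)
have [betaT|/negPf betaF] := boolP beta.
  constructor 3; exists G; last exact: G_indep.
  by apply: bijective_of_surj G_inj _ => U; apply: G_surj; rewrite inE betaT orbT.
constructor 2; exists (zero_sum 'F_p k); first exact: zero_sum_hyperplane.
have P_eq : P = ~: zero_sum 'F_p k by apply/setP=> U; rewrite !inE betaF orbF.
have GH x : G x \in ~: zero_sum 'F_p k by rewrite -P_eq.
(* The same map, with the ground set of [AG] as codomain. *)
pose G' x : {U | U \in ~: zero_sum 'F_p k} := exist _ (G x) (GH x).
exists G'.
  apply: bijective_of_surj => [x y /(congr1 val)/G_inj //|[U UH]].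
  have [|x GxU] := G_surj U; first by rewrite P_eq.
  by exists x; apply: val_inj.
move=> S; rewrite -G_indep /= /restr_indep /= -imset_comp.
by congr pg_indep; apply: eq_imset.
Qed.
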